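(* Let $\theta>1$ and let $\omega\in(0,1)$ be the solution of $\frac{e^{\omega}}{e^{\omega}-1}=\frac{\ln\theta}{1-\omega}$. No online algorithm, deterministic or randomized, for the online assignment problem with maximum fluctuation ratio $\theta$ can achieve a competitive ratio smaller than $\frac{e^{\omega}}{e^{\omega}-1}$. That is, there is no constant $c<\frac{e^{\omega}}{e^{\omega}-1}$ such that for every number $K$ of items, all capacities $C_1,\dots,C_K$ and all valuation bounds with $\max_k U_k/L_k=\theta$ there is a (possibly randomized) online algorithm with competitive ratio at most $c$.
   Context: Online assignment problem: a seller has $K$ items, item $k$ with $C_k\ge1$ identical copies. Buyers $n=1,\dots,N$ arrive one at a time; buyer $n$ has private valuations $v_{n,k}$, where $v_{n,k}=0$ if buyer $n$ is not interested in item $k$ and $v_{n,k}\in[L_k,U_k]$ ($0<L_k\le U_k$) otherwise. An instance is $I=\{v_{n,k}\}_{n\in[N],k\in[K]}$. The fluctuation ratio of item $k$ is $\theta_k=U_k/L_k$ and $\theta=\max_k\theta_k$. When buyer $n$ arrives, prices $\{p_{n,k}\}_{k}$ are posted, and the buyer buys one copy of an available item maximizing $v_{n,k}-p_{n,k}$ if this maximum is non-negative, and otherwise buys nothing; $x_{n,k}\in\{0,1\}$ indicates whether buyer $n$ buys item $k$. At most $C_k$ copies of item $k$ may be sold and decisions are irrevocable. An online algorithm determines the prices for buyer $n$ based only on the past purchase decisions $\{x_{i,k}\}_{i<n,k\in[K]}$, without knowledge of future buyers or $N$; a randomized online algorithm is a probability distribution over deterministic ones. The social welfare is $\sum_{n,k}v_{n,k}x_{n,k}$;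 $\mathrm{ALG}(I)$ denotes that of the algorithm, and $\mathrm{OPT}(I)$ is its maximum over $x_{n,k}\in\{0,1\}$ subject to $\sum_n x_{n,k}\le C_k$ for all $k$ and $\sum_k x_{n,k}\le1$ for all $n$. The competitive ratio is $\sup_I\mathrm{OPT}(I)/\mathbb{E}[\mathrm{ALG}(I)]$. *)

(* Defs.v *)
From HB Require Import structures.
From mathcomp Require Import all_boot all_order all_algebra.
From mathcomp Require Import all_classical all_reals all_analysis.
Set Implicit Arguments.
Unset Strict Implicit.
Unset Printing Implicit Defensive.
Import Order.TTheory GRing.Theory Num.Theory.
Local Open Scope ring_scope.

(* An instance with N buyers and K items is v : 'M[R]_(N, K), and an
   allocation is x : 'M[bool]_(N, K); buyers arrive in the order of 'I_N. *)

Definition valid_instance (R : realType) (K N : nat) (L U : 'I_K -> R)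
    (v : 'M[R]_(N, K)) : Prop :=
  forall n k, v n k = 0 \/ L k <= v n k <= U k.

(* The default 0 is never attained when K > 0 and 0 < L k <= U k. *)
Definition max_fluctuation (R : realType) (K : nat) (L U : 'I_K -> R) : R :=
  \big[Num.max/0]_(k < K) (U k / L k).

Definition welfare (R : realType) (K N : nat) (v : 'M[R]_(N, K))
    (x : 'M[bool]_(N, K)) : R :=
  \sum_(n < N) \sum_(k < K) v n k * (x n k)%:R.

Definition feasible (K N : nat) (C : 'I_K -> nat) (x : 'M[bool]_(N, K)) : bool :=
  [forall k, (\sum_(n < N) x n k <= C k)%N] &&
  [forall n, (\sum_(k < K) x n k <= 1)%N].

(* The null allocation is feasible, so the default 0 is harmless. *)
Definition opt (R : realType) (K N : nat) (C : 'I_K -> nat)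
    (v : 'M[R]_(N, K)) : R :=
  \big[Num.max/0]_(x : 'M[bool]_(N, K) | feasible C x) welfare v x.

(* Past decisions, oldest first: Some k for the purchase of item k, None for
   no purchase.  The size of a history is the number of past buyers. *)
Definition history (K : nat) : Type := seq (option 'I_K).

Definition available (K : nat) (C : 'I_K -> nat) (h : history K) (k : 'I_K) : bool :=
  (count_mem (Some k) h < C k)%N.

(* A deterministic online algorithm: the prices posted for the next buyer. *)
Definition pricing (R : realType) (K : nat) : Type := history K -> 'rV[R]_K.

(* b h v p is the decision, after h, of a buyer with valuations v who is
   offered prices p. *)
Definition buyer_rule (R : realType) (K : nat) : Type :=
  history K -> 'rV[R]_K -> 'rV[R]_K -> option 'I_K.

(* Utility maximization leaves the choice among several maximizers open: the
   rational rules differ exactly by their tie-breaking. *)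
Definition rational (R : realType) (K : nat) (C : 'I_K -> nat)
    (b : buyer_rule R K) : Prop :=
  forall h v p,
    match b h v p with
    | Some k =>
        [/\ available C h k,
            forall j, available C h j -> v 0 j - p 0 j <= v 0 k - p 0 k
          & 0 <= v 0 k - p 0 k]
    | None => forall j, available C h j -> v 0 j - p 0 j < 0
    end.

Definition run (R : realType) (K N : nat) (A : pricing R K) (b : buyer_rule R K)
    (v : 'M[R]_(N, K)) : history K :=
  foldl (fun h vn => rcons h (b h vn (A h))) [::] [seq row n v | n <- enum 'I_N].

Definition allocation (R : realType) (K N : nat) (A : pricing R K)
    (b : buyer_rule R K) (v : 'M[R]_(N, K)) : 'M[bool]_(N, K) :=
  \matrix_(n, k) (nth None (run A b v) n == Some k).

Definition alg (R : realType) (K N : nat) (A : pricing R K) (b : buyer_rule R K)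
    (v : 'M[R]_(N, K)) : R :=
  welfare v (allocation A b v).

(* A randomized online algorithm is a family A of deterministic ones indexed by
   a probability space T.  The buyers' tie-breaking b may be random too, and
   correlated with A; a constant b is a fixed deterministic tie-breaking, and
   constant A and b give a deterministic algorithm. *)

Definition measurable_welfare (R : realType) (K : nat) (L U : 'I_K -> R)
    (d : measure_display) (T : measurableType d)
    (A : T -> pricing R K) (b : T -> buyer_rule R K) : Prop :=
  forall (N : nat) (v : 'M[R]_(N, K)), valid_instance L U v ->
    measurable_fun [set: T] (fun t => alg (A t) (b t) v).

(* In \bar R, x / 0 = +oo for x > 0, whereas 0 / 0 = 0: an instance of zero
   optimal welfare puts no constraint on the ratio. *)
Definition competitive_ratio (R : realType) (K : nat) (C : 'I_K -> nat)
    (L U : 'I_K -> R) (d : measure_display) (T : measurableType d)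
    (P : probability T R) (A : T -> pricing R K) (b : T -> buyer_rule R K) : \bar R :=
  ereal_sup [set r | exists (N : nat) (v : 'M[R]_(N, K)),
    valid_instance L U v /\
    r = ((opt C v)%:E / 'E_P[fun t => alg (A t) (b t) v])%E].

(* Used negatively, so that the resulting lower bound holds for every
   tie-breaking. *)
Definition achievable (R : realType) (K : nat) (C : 'I_K -> nat)
    (L U : 'I_K -> R) (c : R) : Prop :=
  exists (d : measure_display) (T : measurableType d) (P : probability T R)
         (A : T -> pricing R K) (b : T -> buyer_rule R K),
    [/\ forall t, rational C (b t),
        measurable_welfare L U A b
      & (competitive_ratio C L U P A b <= c%:E)%E].

(* Main.v *)
(* All capacities are 1 and all valuations lie in [1, theta].  While there are
   more than d items left on offer, a buyer arrives who values each of them at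
   1, and then a uniformly chosen one of them is withdrawn.  The survivors are
   next offered to d buyers at each of the levels q ^- 0, ..., q ^- n, where
   q ^- n = theta, and the instance may stop after any level.  An item sold
   while k are on offer survives with probability d / k, so early sales use up
   the survivors; on the other hand, if S items are sold early out of K,
   staying c-competitive at every level takes about
   (K + d ln theta) / c - S further sales of survivors.  With K = e^omega d items,
   counting the copies of the survivors gives, as d tends to infinity,
   c (e^omega - omega) >= e^omega + ln theta, which for the given omega is
   c >= e^omega / (e^omega - 1). *)

Require Import Defs.
From mathcomp Require Import all_boot all_order all_algebra.
From mathcomp Require Import all_classical all_reals all_analysis.
From mathcomp Require Import ring lra.
Import Order.TTheory GRing.Theory Num.Theory.
Local Open Scope ring_scope.
Set Implicit Arguments.
Unset Strict Implicit.

(** * Instances as growing lists of buyers, and the counting of sales *)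

Section Lists.
Context {R : realType} {K : nat}.
Implicit Types (rs : seq 'rV[R]_K) (o h : history K) (D : {set 'I_K}) (p : R).

Definition value (v : 'rV[R]_K) (o : option 'I_K) : R :=
  if o is Some k then v 0 k else 0.

Definition gain rs o : R := \sum_(x <- zip rs o) value x.1 x.2.

(** The adversary appends buyers, so its instances are lists of rows; this returns them to the
    matrix form expected by [opt] and [alg]. *)
Definition instance_of rs : 'M[R]_(size rs, K) :=
  \matrix_(n < size rs, k < K) nth 0 rs n 0 k.

Definition purchases (A : pricing R K) (b : buyer_rule R K) rs : history K :=
  foldl (fun h v => rcons h (b h v (A h))) [::] rs.

Lemma gain_cat rs rs' o o' : size rs = size o ->
  gain (rs ++ rs') (o ++ o') = gain rs o + gain rs' o'.
Proof. by move=> so; rewrite /gain zip_cat // big_cat. Qed.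

Lemma gain_rcons rs o v k : size rs = size o ->
  gain (rcons rs v) (rcons o k) = gain rs o + value v k.
Proof. by move=> so; rewrite -!cats1 gain_cat // /gain /= big_seq1. Qed.

Lemma gain_None rs n : gain rs (nseq n None) = 0.
Proof.
elim: rs n => [|v rs IH] [|n]; rewrite /gain ?big_nil //= big_cons /= add0r.
exact: IH.
Qed.

Lemma size_purchases A b rs : size (purchases A b rs) = size rs.
Proof.
elim/last_ind: rs => // rs v IH.
by rewrite /purchases -cats1 foldl_cat /= !size_rcons size_cat addn1 -IH.
Qed.

Lemma purchases_rcons A b rs v :
  purchases A b (rcons rs v) =
  rcons (purchases A b rs) (b (purchases A b rs) v (A (purchases A b rs))).
Proof. by rewrite /purchases -cats1 foldl_cat. Qed.

Lemma rows_instance_of rs :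
  [seq row n (instance_of rs) | n <- enum 'I_(size rs)] = rs.
Proof.
apply: (@eq_from_nth _ 0); first by rewrite size_map size_enum_ord.
move=> i; rewrite size_map size_enum_ord => lti.
rewrite (nth_map (Ordinal lti)) ?size_enum_ord //.
by apply/rowP => k; rewrite !mxE nth_enum_ord.
Qed.

Lemma run_instance_of A b rs : run A b (instance_of rs) = purchases A b rs.
Proof. by rewrite /run rows_instance_of. Qed.

Lemma welfare_instance_of rs o : size o = size rs ->
  welfare (instance_of rs) (\matrix_(n, k) (nth None o n == Some k)) = gain rs o.
Proof.
move=> so; rewrite /welfare /gain (big_nth (0, None)) big_mkord size_zip so minnn.
apply: eq_bigr => i _; rewrite nth_zip //= /value.
case E: (nth None o i) => [k|].
  rewrite (bigD1 k) //= !mxE E eqxx mulr1 big1 ?addr0 // => j jk.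
  by rewrite !mxE E (inj_eq Some_inj) eq_sym (negbTE jk) mulr0.
by rewrite big1 // => j _; rewrite !mxE E mulr0.
Qed.

Lemma alg_instance_of A b rs :
  alg A b (instance_of rs) = gain rs (purchases A b rs).
Proof.
rewrite /alg /allocation run_instance_of welfare_instance_of //.
exact: size_purchases.
Qed.

(** A history names at most one item per buyer by its type, so feasibility reduces to the
    capacities. *)
Lemma gain_le_opt (C : 'I_K -> nat) rs o : size o = size rs ->
  (forall k, (count_mem (Some k) o <= C k)%N) ->
  gain rs o <= opt C (instance_of rs).
Proof.
move=> so oC; rewrite -welfare_instance_of //.
apply: le_bigmax_cond; apply/andP; split; apply/forallP => i.
  apply: leq_trans (oC i); rewrite -sum1_count [leqRHS]big_mkcond (big_nth None) big_mkord so.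
  by apply: leq_sum => j _; rewrite mxE /=; case: (_ == _).
case E: (nth None o i) => [k|].
  rewrite (bigD1 k) //= mxE E eqxx big1 // => j jk.
  by rewrite mxE E (inj_eq Some_inj) eq_sym (negbTE jk).
by rewrite big1 // => j _; rewrite mxE E.
Qed.

Definition sales D h : nat := #|[set k in D | Some k \in h]|.

Definition offer p D : 'rV[R]_K := \row_k (if k \in D then p else 0).

Lemma sales_le D h : (sales D h <= #|D|)%N.
Proof. by apply: subset_leq_card; apply/fintype.subsetP => k; rewrite inE => /andP[]. Qed.

Lemma sales_rcons D h (o : option 'I_K) :
  sales D (rcons h o) =
  (sales D h + (if o is Some k then (k \in D) && (Some k \notin h) else false))%N.
Proof.
rewrite /sales; case: o => [k|]; last first.
  by rewrite addn0; apply: eq_card => j; rewrite !inE mem_rcons inE.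
case: (boolP ((k \in D) && (Some k \notin h))) => [/andP[kD kh]|kDh].
  have -> : [set j in D | Some j \in rcons h (Some k)] = k |: [set j in D | Some j \in h].
    apply/setP => j; rewrite !inE mem_rcons inE (inj_eq Some_inj).
    by case: eqP => // ->; rewrite kD.
  by rewrite cardsU1 !inE kD (negbTE kh) addnC.
rewrite addn0; apply: eq_card => j; rewrite !inE mem_rcons inE (inj_eq Some_inj).
by case: eqP => //= ->; move: kDh; case: (k \in D) => //= /negbNE.
Qed.

(** Double counting: a sold item of [D] is spared by [#|D|.-1] of the choices of the withdrawn item
    [k]. This is how a uniform withdrawal thins out the early sales. *)
Lemma sum_sales D h :
  (\sum_(k in D) sales (D :\ k) h = #|D|.-1 * sales D h)%N.
Proof.
transitivity (\sum_(k in D) \sum_(j in D | Some j \in h) (j != k))%N.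
  apply: eq_bigr => k kD; rewrite /sales -sum1_card big_mkcond [RHS]big_mkcond.
  by apply: eq_bigr => j _; rewrite !inE; case: (j \in D); case: (j == k); case: (_ \in h).
rewrite exchange_big /= /sales.
under eq_bigr => j /andP[jD _].
  have -> : (\sum_(k in D) (j != k) = #|D|.-1)%N.
    rewrite (bigD1 j) //= eqxx add0n (cardsD1 j) jD /= -sum1_card.
    apply: eq_big => [k|k]; first by rewrite !inE andbC.
    by move=> /andP[_ kj]; rewrite eq_sym kj.
  over.
by rewrite sum_nat_const mulnC; congr (_ * _)%N; apply: eq_card => k; rewrite !inE.
Qed.

End Lists.

(** * Welfare earned by a deterministic algorithm under unit capacities *)

Section Deterministic.
Context {R : realType} {K : nat} (A : pricing R K) (b : buyer_rule R K).
Hypothesis rat : Defs.rational (fun=> 1%N) b.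
Implicit Types (rs : seq 'rV[R]_K) (D : {set 'I_K}) (p : R).

Definition alg_gain rs := gain rs (purchases A b rs).

Definition sold D rs : R := (sales D (purchases A b rs))%:R.

(** With unit capacities a rational buyer takes only an item absent from the history, so a sale
    within [D] always raises [sales] by one. A sale outside [D], possible at a price at most 0, is
    worth 0 and changes neither side. *)
Lemma alg_gain_rcons rs p D :
  alg_gain (rcons rs (offer p D)) - alg_gain rs =
  p * (sold D (rcons rs (offer p D)) - sold D rs).
Proof.
rewrite /alg_gain /sold purchases_rcons gain_rcons ?size_purchases // sales_rcons.
set h := purchases A b rs; rewrite natrD [X in X - _]addrC addrK.
rewrite [in RHS]addrC addKr.
have := rat h (offer p D) (A h).
case: (b _ _ _) => [k [av _ _]|_] /=; last by rewrite mulr0.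
have -> : Some k \notin h.
  by apply/count_memPn/eqP; move: av; rewrite /available ltnS leqn0.
by rewrite andbT mxE; case: (k \in D); rewrite ?mulr1 ?mulr0.
Qed.

Lemma sold_rcons_le1 rs v D : sold D (rcons rs v) - sold D rs <= 1.
Proof.
rewrite /sold purchases_rcons sales_rcons natrD [in X in X - _]addrC addrK.
by case: (b _ _ _) => [k|]; rewrite ?ler01 // lern1 leq_b1.
Qed.

Lemma alg_gain_nseq rs p D n :
  alg_gain (rs ++ nseq n (offer p D)) - alg_gain rs =
  p * (sold D (rs ++ nseq n (offer p D)) - sold D rs).
Proof.
elim: n rs => [|n IH] rs; first by rewrite cats0 !subrr mulr0.
rewrite -cat_rcons.
have := IH (rcons rs (offer p D)); have := alg_gain_rcons rs p D; lra.
Qed.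

End Deterministic.

(** * The rising levels of valuation and the offline allocations against them *)

Section Stages.
Context {R : realType} {K : nat} (theta q : R) (d : nat).
Implicit Types (rs : seq 'rV[R]_K) (D : {set 'I_K}).
Hypotheses (q01 : 0 < q <= 1).

(** Level [q ^- n] is first reached by [stages rs D n.+1], whence the shift in what follows. *)
Fixpoint stages rs D n : seq 'rV[R]_K :=
  if n is n'.+1 then stages rs D n' ++ nseq d (offer (q ^- n') D) else rs.

Definition valid_rows rs : Prop :=
  forall v, v \in rs -> forall k, v 0 k = 0 \/ 1 <= v 0 k <= theta.

(** An offline allocation that keeps all of [D] in reserve, to be sold at whichever level turns out
    to be the last. *)
Definition plan D rs (z : R) : Prop :=
  exists o : history K, [/\ size o = size rs,
    forall k, (count_mem (Some k) o <= (k \notin D))%N & gain rs o = z].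

Lemma valid_rows_offer p D n : 1 <= p <= theta ->
  valid_rows (nseq n (offer p D)).
Proof.
move=> p1 v; rewrite mem_nseq => /andP[_ /eqP ->] k; rewrite mxE.
by case: ifP => _; [right|left].
Qed.

Lemma valid_rows_cat rs rs' :
  valid_rows rs -> valid_rows rs' -> valid_rows (rs ++ rs').
Proof. by move=> vr vr' v; rewrite mem_cat => /orP[/vr|/vr']. Qed.

Lemma price_bounds n j : q ^- n <= theta -> (j <= n)%N -> 1 <= q ^- j <= theta.
Proof.
move=> qn jn; have [q0 q1] := andP q01; apply/andP; split.
  by rewrite invf_ge1 ?exprn_gt0 // exprn_ile1 // ltW.
apply: le_trans qn; rewrite lef_pV2 ?posrE ?exprn_gt0 //.
by rewrite ler_wiXn2l // ltW.
Qed.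

Lemma valid_rows_stages rs D n : valid_rows rs -> q ^- n <= theta ->
  forall j, (j <= n.+1)%N -> valid_rows (stages rs D j).
Proof.
move=> vr qn; elim=> [|j IH] //= jn; apply: valid_rows_cat; first by apply: IH; apply: ltnW.
exact/valid_rows_offer/(price_bounds qn).
Qed.

Lemma plan_stages rs D z n : plan D rs z -> plan D (stages rs D n) z.
Proof.
move=> pl; elim: n => [//|n [r [so co go]]] /=.
exists (r ++ nseq d None); split.
- by rewrite !size_cat so !size_nseq.
- by move=> k; rewrite count_cat count_nseq /= mul0n addn0.
- by rewrite gain_cat // gain_None addr0.
Qed.

(** The offline allocation gives the buyer the very item that is withdrawn next, so every buyer of
    the withdrawal phase is served without touching the survivors. *)
Lemma plan_rcons rs D k z : k \in D ->
  plan D rs z -> plan (D :\ k) (rcons rs (offer 1 D)) (z + 1).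
Proof.
move=> kD [r [so co go]]; exists (rcons r (Some k)); split.
- by rewrite !size_rcons so.
- move=> j; rewrite -cats1 count_cat /= addn0 !inE (inj_eq Some_inj).
  rewrite [j == k]eq_sym; have := co j; case: (eqVneq k j) => [<-|_] /=.
    by rewrite kD leqn0 => /eqP ->.
  by rewrite addn0.
- by rewrite gain_rcons // go /= mxE kD.
Qed.

Lemma gain_serve_all (p : R) D :
  gain (nseq #|D| (offer p D) : seq 'rV[R]_K) [seq Some k | k <- enum D] = p *+ #|D|.
Proof.
rewrite /gain cardE; have : all (mem D) (enum D).
  by apply/allP => k; rewrite mem_enum.
elim: (enum D) => [|k s IH] /=; first by rewrite big_nil.
by move=> /andP[kD /IH IHs]; rewrite big_cons /= IHs mxE kD mulrS.
Qed.

(** All lower levels are skipped, and the [d] reserved items go to the [d] buyers of the last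
    level. *)
Lemma plan_serve rs D z n : #|D| = d -> plan D rs z ->
  exists o : history K, [/\ size o = size (stages rs D n.+1),
    forall k, (count_mem (Some k) o <= 1)%N &
    gain (stages rs D n.+1) o = z + d%:R * q ^- n].
Proof.
move=> Dd /(plan_stages n)[r [so co go]].
exists (r ++ [seq Some k | k <- enum D]); split.
- by rewrite /= !size_cat so size_map -cardE Dd size_nseq.
- move=> k; rewrite count_cat count_map.
  rewrite (@eq_count _ _ (pred1 k)); last by move=> j; rewrite /= (inj_eq Some_inj).
  rewrite (count_uniq_mem _ (enum_uniq _)) mem_enum.
  by have := co k; case: (k \in D) => /=; case: count => [|[]].
- by rewrite /= gain_cat // go -{1}Dd gain_serve_all Dd mulr_natl.
Qed.

(* Summation by parts, since a sale in stage [j] is worth [q ^- j]. *)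
Lemma sold_stages A b rs D n : Defs.rational (fun=> 1%N) b ->
  sold A b D (stages rs D n.+1) - sold A b D rs + alg_gain A b rs =
  \sum_(j < n) (q ^+ j * (1 - q)) * alg_gain A b (stages rs D j.+1)
  + q ^+ n * alg_gain A b (stages rs D n.+1).
Proof.
move=> rat; have q0 : q != 0 by case/andP: q01 => /gt_eqF ->.
pose a j := alg_gain A b (stages rs D j); pose s j := sold A b D (stages rs D j).
have step j : q ^+ j * (a j.+1 - a j) = s j.+1 - s j.
  by rewrite /a /s /= alg_gain_nseq // mulrA divff ?mul1r // expf_neq0.
suff : s n.+1 - s 0%N + a 0%N = \sum_(j < n) (q ^+ j * (1 - q)) * a j.+1 + q ^+ n * a n.+1 by [].
move: a s step => a s step.
elim: n => [|n IH].
  by have := step 0%N; rewrite big_ord0 expr0; lra.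
have := step n.+1; rewrite big_ord_recr /= exprS; lra.
Qed.

End Stages.

(** * Lower bounds on expectations *)

Section Mean.
Context {R : realType} {d : measure_display} {T : measurableType d}.
Variable P : probability T R.
Implicit Types (f g : T -> R) (m a : R).

(** Integrability is bundled with the bound so that such bounds are closed under nonnegative
    combinations; [mean_ge_le] then confronts them with a bound valid at every [t]. *)
Definition mean_ge m f : Prop :=
  P.-integrable [set: T] (EFin \o f) /\ (m%:E <= \int[P]_t (f t)%:E)%E.

Lemma mean_ge0 : mean_ge 0 (fun=> 0).
Proof. by split; [exact: integrable0|rewrite integral0]. Qed.

Lemma mean_geD m1 m2 f g :
  mean_ge m1 f -> mean_ge m2 g -> mean_ge (m1 + m2) (fun t => f t + g t).
Proof.
move=> [intf mf] [intg mg]; split; first exact: (integrableD measurableT intf intg).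
by under eq_integral do rewrite EFinD; rewrite integralD // EFinD leeD.
Qed.

Lemma mean_geZ a m f : 0 <= a -> mean_ge m f -> mean_ge (a * m) (fun t => a * f t).
Proof.
move=> a0 [intf mf]; split; first exact: (integrableZl measurableT a intf).
by under eq_integral do rewrite EFinM; rewrite integralZl // EFinM lee_wpmul2l.
Qed.

Lemma mean_ge_sum (I : finType) (Q : pred I) (m : I -> R) (f : I -> T -> R) :
  (forall i, Q i -> mean_ge (m i) (f i)) ->
  mean_ge (\sum_(i | Q i) m i) (fun t => \sum_(i | Q i) f i t).
Proof.
move=> H; have -> : (fun t => \sum_(i | Q i) f i t) = \sum_(i | Q i) f i.
  by apply/funext => t; rewrite fct_sumE.
by elim/big_rec2: _ => [|i g a Qi]; [exact: mean_ge0|apply: mean_geD; exact: H].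
Qed.

Lemma mean_ge_le m f a : mean_ge m f -> (forall t, f t <= a) -> m <= a.
Proof.
move=> [intf mf] fa; rewrite -lee_fin; apply: le_trans mf _.
have <- : (\int[P]_t (cst a t)%:E = a%:E)%E.
  by rewrite (integral_cst P measurableT a%:E) [X in (_ * X)%E]probability_setT mule1.
apply: le_integral => //; first exact: finite_measure_integrable_cst.
by move=> t _; rewrite lee_fin.
Qed.

End Mean.

(** * From the competitive ratio to expected welfare on one instance *)

Section Achievable.
Context {R : realType} {K : nat} (theta c : R) (d : measure_display)
  (T : measurableType d) (P : probability T R)
  (A : T -> pricing R K) (b : T -> buyer_rule R K).
Implicit Types (rs : seq 'rV[R]_K).

Lemma competitive_mean_ge rs (o : history K) :
  measurable_welfare (fun=> 1%R) (fun=> theta) A b ->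
  (competitive_ratio (fun=> 1%N) (fun=> 1%R) (fun=> theta) P A b <= c%:E)%E ->
  valid_rows theta rs -> size o = size rs ->
  (forall k, (count_mem (Some k) o <= 1)%N) -> 0 < gain rs o ->
  0 < c /\ mean_ge P (gain rs o / c) (fun t => alg_gain (A t) (b t) rs).
Proof.
move=> meas ratio vr so oC o0.
have vI : valid_instance (fun=> 1%R) (fun=> theta) (instance_of rs).
  move=> n k; rewrite mxE; apply: vr; exact: mem_nth.
have oopt := gain_le_opt so oC.
have g0 t : 0 <= alg_gain (A t) (b t) rs.
  rewrite /alg_gain -alg_instance_of; apply: sumr_ge0 => n _; apply: sumr_ge0 => k _.
  by rewrite mulr_ge0 // ?ler0n //; case: (vI n k) => [->//|/andP[/(le_trans ler01)]].
(* A bound independent of [t] makes the measurable welfare integrable. *)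
have gB t : alg_gain (A t) (b t) rs <= \sum_n \sum_k instance_of rs n k.
  rewrite /alg_gain -alg_instance_of; apply: ler_sum => n _; apply: ler_sum => k _.
  have v0 : 0 <= instance_of rs n k.
    by case: (vI n k) => [->//|/andP[/(le_trans ler01)]].
  by case: (allocation _ _ _ n k); rewrite ?mulr1 ?mulr0.
have mg : measurable_fun [set: T] (fun t => alg_gain (A t) (b t) rs).
  have := meas _ _ vI; congr measurable_fun; apply/funext => t.
  by rewrite alg_instance_of.
have intg : P.-integrable [set: T] (EFin \o (fun t => alg_gain (A t) (b t) rs)).
  apply: measurable_bounded_integrable => //.
    by rewrite [X in (X < _)%E]probability_setT ltry.
  exists (\sum_n \sum_k instance_of rs n k); split; first exact: num_real.
  move=> x Bx t _ /=; rewrite ger0_norm //.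
  exact: le_trans (gB t) (ltW Bx).
set e := fine (\int[P]_t (alg_gain (A t) (b t) rs)%:E).
have eE : 'E_P[fun t => alg (A t) (b t) (instance_of rs)]%E = e%:E.
  rewrite unlock /e fineK; last exact: integrable_fin_num.
  by apply: eq_integral => t _; rewrite alg_instance_of.
have e0 : 0 <= e.
  by apply: fine_ge0; apply: integral_ge0 => t _; rewrite lee_fin.
have : ((opt (fun=> 1%N) (instance_of rs))%:E / e%:E <= c%:E)%E.
  rewrite -eE; apply: le_trans ratio; apply: ereal_sup_ubound.
  by exists (size rs), (instance_of rs).
have opt0 := lt_le_trans o0 oopt.
(* Zero expected welfare would make the ratio [+oo], since the optimum is positive. *)
rewrite inver; case: eqP => [_|/eqP en0].
  by rewrite gt0_muley ?lte_fin // leye_eq.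
have {}e0 : 0 < e by rewrite lt_neqAle eq_sym en0.
rewrite -EFinM lee_fin ler_pdivrMr // => optc.
have c0 : 0 < c.
  by have := lt_le_trans opt0 optc; rewrite pmulr_lgt0.
split=> //; split=> //.
rewrite -[leRHS]fineK; last exact: integrable_fin_num.
by rewrite lee_fin ler_pdivrMr // -/e mulrC (le_trans oopt).
Qed.

End Achievable.

(** * The random withdrawals, averaged against an arbitrary algorithm *)

Section Adversary.
Context {R : realType} {K : nat} (theta q c : R) (d n : nat)
  {disp : measure_display} {T : measurableType disp} (P : probability T R)
  (A : T -> pricing R K) (b : T -> buyer_rule R K).
Hypotheses (q01 : 0 < q <= 1) (q_theta : q ^- n <= theta) (d_gt0 : (0 < d)%N).
Hypothesis rat : forall t, Defs.rational (fun=> 1%N) (b t).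
Hypothesis competitive : forall rs (o : history K),
  valid_rows theta rs -> size o = size rs ->
  (forall k, (count_mem (Some k) o <= 1)%N) -> 0 < gain rs o ->
  mean_ge P (gain rs o / c) (fun t => alg_gain (A t) (b t) rs).

(** Stopping after level [j] forces expected welfare at least [(z + d q^-j) / c]. In the weighted
    sum of [sold_stages] the weights of [z] telescope to 1, while each level [j < n] contributes
    [d (1 - q)] and the last one [d]. *)
Lemma mean_ge_stages rs (D : {set 'I_K}) (z : R) : #|D| = d -> 0 <= z ->
  valid_rows theta rs -> plan D rs z ->
  mean_ge P ((z + d%:R * (1 + n%:R * (1 - q))) / c)
    (fun t => sold (A t) (b t) D (stages q d rs D n.+1)
              - sold (A t) (b t) D rs + alg_gain (A t) (b t) rs).
Proof.
move=> Dd z0 vr pl; have [q0 q1] := andP q01.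
have stage j : (j <= n)%N -> mean_ge P ((z + d%:R * q ^- j) / c)
    (fun t => alg_gain (A t) (b t) (stages q d rs D j.+1)).
  move=> jn; have [r [so oC go]] := plan_serve q j Dd pl.
  rewrite -go; apply: competitive => //.
    exact: valid_rows_stages q01 _ _ _ vr q_theta _ _.
  by rewrite go ltr_wpDl // mulr_gt0 ?ltr0n // invr_gt0 exprn_gt0.
have -> : (z + d%:R * (1 + n%:R * (1 - q))) / c =
    \sum_(j < n) (q ^+ j * (1 - q)) * ((z + d%:R * q ^- j) / c)
    + q ^+ n * ((z + d%:R * q ^- n) / c).
  have qn j : q ^+ j * ((z + d%:R * q ^- j) / c) = q ^+ j * (z / c) + d%:R / c.
    by rewrite mulrA mulrDr mulrCA divff ?mulr1 ?expf_neq0 ?gt_eqF // mulrDl mulrA.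
  rewrite qn; elim: (n) => [|j IH]; first by rewrite big_ord0 expr0; lra.
  rewrite big_ord_recr /= exprS -natr1.
  by rewrite [q ^+ j * _ * _]mulrAC qn; lra.
have -> : (fun t => sold (A t) (b t) D (stages q d rs D n.+1)
              - sold (A t) (b t) D rs + alg_gain (A t) (b t) rs) =
    (fun t => \sum_(j < n) (q ^+ j * (1 - q)) *
      alg_gain (A t) (b t) (stages q d rs D j.+1)
    + q ^+ n * alg_gain (A t) (b t) (stages q d rs D n.+1)).
  by apply/funext => t; apply: sold_stages.
apply: mean_geD; last by apply: mean_geZ; [rewrite exprn_ge0 // ltW|apply: stage].
apply: mean_ge_sum => j _; apply: mean_geZ; last by apply: stage; apply: ltnW.
by rewrite mulr_ge0 ?subr_ge0 // exprn_ge0 // ltW.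
Qed.

(* [F] averages over the [j] items that are still to be withdrawn, each chosen
   uniformly among those on offer.  The bound holds for every [t] because only
   total welfares, not the individual purchases, are measurable in [t]. *)
Lemma adversary_average j rs (D : {set 'I_K}) :
  #|D| = (d + j)%N -> valid_rows theta rs -> plan D rs (size rs)%:R ->
  exists2 F : T -> R,
    mean_ge P (((size rs + j)%:R + d%:R * (1 + n%:R * (1 - q))) / c) F &
    forall t, F t + d%:R / (d + j)%:R * sold (A t) (b t) D rs
      - alg_gain (A t) (b t) rs + \sum_(i < j) (d%:R / (d + i.+1)%:R - 1) <= d%:R.
Proof.
elim: j rs D => [|j IH] rs D Dd vr pl.
  rewrite !addn0 in Dd *.
  (* No withdrawal is left: only the [d] survivors can still be sold, which bounds this function at
     every [t]. *)
  exists (fun t => sold (A t) (b t) D (stages q d rs D n.+1)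
              - sold (A t) (b t) D rs + alg_gain (A t) (b t) rs).
    by apply: mean_ge_stages; rewrite ?ler0n.
  move=> t; rewrite big_ord0 addr0 divff ?pnatr_eq0 -?lt0n // mul1r.
  have : sold (A t) (b t) D (stages q d rs D n.+1) <= d%:R.
    by rewrite ler_nat -Dd sales_le.
  lra.
pose rs' := rcons rs (offer 1 D).
have vr' : valid_rows theta rs'.
  rewrite /rs' -cats1; apply: valid_rows_cat vr _.
  apply: (@valid_rows_offer _ _ theta 1 D 1); rewrite lexx /=.
  by have := price_bounds q01 q_theta (leq0n n); rewrite expr0 invr1 lexx.
(* One function for each candidate [k] for withdrawal; outside [D] the value is arbitrary. *)
have /choice[F HF] : forall k, exists Fk : T -> R, k \in D ->
    mean_ge P (((size rs + j.+1)%:R + d%:R * (1 + n%:R * (1 - q))) / c) Fk /\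
    forall t, Fk t + d%:R / (d + j)%:R * sold (A t) (b t) (D :\ k) rs'
      - alg_gain (A t) (b t) rs' + \sum_(i < j) (d%:R / (d + i.+1)%:R - 1) <= d%:R.
  move=> k; have [kD|_] := boolP (k \in D); last by exists (fun=> 0).
  have [ | | |F mF bF] := IH rs' (D :\ k).
  - by apply: succn_inj; rewrite -addnS -Dd (cardsD1 k D) kD.
  - exact: vr'.
  - by rewrite size_rcons -natr1; apply: plan_rcons.
  - by exists F => _; rewrite -addSnnS -(size_rcons rs (offer 1 D)).
have N0 : 0 < (d + j.+1)%:R :> R by rewrite ltr0n addnS.
exists (fun t => (d + j.+1)%:R^-1 * \sum_(k in D) F k t).
  set m := (X in mean_ge P X _).
  have -> : m = (d + j.+1)%:R^-1 * \sum_(k in D) m.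
    by rewrite sumr_const Dd -[m *+ _]mulr_natl mulKf // gt_eqF.
  apply: mean_geZ; first by rewrite invr_ge0 ltW.
  by apply: mean_ge_sum => k kD; have [] := HF k kD.
move=> t; set H := \sum_(i < j) _ in HF.
rewrite big_ord_recr /= -/H.
(* Summing the induction bounds over [k], [sum_sales] yields a factor [d + j] that cancels the
   denominator of the survival probability [d / (d + j)]. *)
have sumF : \sum_(k in D) F k t + d%:R * sold (A t) (b t) D rs'
    + (d + j.+1)%:R * (H - alg_gain (A t) (b t) rs') <= (d + j.+1)%:R * d%:R.
  have sums : \sum_(k in D) sold (A t) (b t) (D :\ k) rs' =
      (d + j)%:R * sold (A t) (b t) D rs'.
    by rewrite /sold -natr_sum sum_sales Dd addnS natrM.
  have -> : \sum_(k in D) F k t + d%:R * sold (A t) (b t) D rs'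
    + (d + j.+1)%:R * (H - alg_gain (A t) (b t) rs') =
    \sum_(k in D) (F k t + d%:R / (d + j)%:R * sold (A t) (b t) (D :\ k) rs'
      - alg_gain (A t) (b t) rs' + H).
    rewrite [RHS](eq_bigr (fun k => F k t + (d%:R / (d + j)%:R * sold (A t) (b t) (D :\ k) rs'
      + (H - alg_gain (A t) (b t) rs')))); last by move=> k _; lra.
    rewrite big_split big_split /= -mulr_sumr sums sumr_const Dd addrA [_%:R * (H - _)]mulr_natl.
    have dj : (d + j)%:R != 0 :> R by rewrite pnatr_eq0 -lt0n ltn_addr.
    by rewrite [_ / _ * _]mulrA divfK.
  rewrite [leRHS](_ : _ = \sum_(k in D) d%:R); last by rewrite sumr_const Dd mulr_natl.
  apply: ler_sum => k kD.
  by have [_] := HF k kD; apply.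
have := alg_gain_rcons (A t) (rat t) rs 1 D; rewrite mul1r -/rs'.
have := sold_rcons_le1 (A t) (b t) rs (offer 1 D) D; rewrite -/rs'.
have dN : d%:R / (d + j.+1)%:R <= 1 :> R by rewrite ler_pdivrMr // mul1r ler_nat leq_addr.
move: sumF dN; set N := (d + j.+1)%:R; rewrite ler_pdivrMr // mul1r.
move=> sumF dN s1 ga; rewrite -(ler_pM2r N0).
rewrite [leLHS](_ : _ = \sum_(k in D) F k t + d%:R * sold (A t) (b t) D rs +
   N * (H - alg_gain (A t) (b t) rs) + d%:R - N); last first.
  by field; rewrite gt_eqF.
(* The new buyer adds some [s <= 1] to both sales and welfare, changing the left side by
   [s (d / N - 1)]. As [d <= N], this is at least [d / N - 1], the term added to the sum. *)
have : (N - d%:R) * (1 - (sold (A t) (b t) D rs' - sold (A t) (b t) D rs)) >= 0.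
  by apply: mulr_ge0; lra.
have -> : alg_gain (A t) (b t) rs =
  alg_gain (A t) (b t) rs' - (sold (A t) (b t) D rs' - sold (A t) (b t) D rs) by lra.
by lra.
Qed.

(** Started with all items on offer and no buyer yet, the sales and welfare terms vanish, and the
    mean of [F] is squeezed between its two bounds. *)
Lemma adversary_bound m : K = (d + m)%N ->
  (m%:R + d%:R * (1 + n%:R * (1 - q))) / c +
  \sum_(i < m) (d%:R / (d + i.+1)%:R - 1) <= d%:R.
Proof.
move=> Km.
have [ | | |F mF bF] := @adversary_average m [::] [set: 'I_K].
- by rewrite cardsT card_ord.
- by [].
- by exists [::]; split=> //; rewrite /gain big_nil.
rewrite -lerBrDr; apply: (mean_ge_le mF) => t; have := bF t.
have -> : alg_gain (A t) (b t) [::] = 0 by rewrite /alg_gain /gain big_nil.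
have -> : sold (A t) (b t) [set: 'I_K] [::] = 0.
  by rewrite /sold /sales eq_card0 // => k; rewrite !inE.
by lra.
Qed.

End Adversary.

(** * The limit of many survivors *)

Lemma harmonic_ge_ln (R : realType) (d m : nat) :
  ln ((d + m).+1%:R / d.+1%:R : R) <= \sum_(i < m) (d + i.+1)%:R^-1.
Proof.
elim: m => [|m IH]; first by rewrite addn0 divff ?pnatr_eq0 // ln1 big_ord0.
(* The new factor is [1 + y] with [y] the new term of the sum, and [ln (1 + y) <= y]. *)
have -> : (d + m.+1).+1%:R / d.+1%:R =
    (d + m).+1%:R / d.+1%:R * (1 + (d + m).+1%:R^-1) :> R.
  by rewrite addnS -[(d + m).+2%:R]natr1; field; rewrite !lt0r_neq0 // ltr0n.
have p0 : 0 < (d + m).+1%:R^-1 :> R by rewrite invr_gt0 ltr0n.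
rewrite lnM ?posrE ?divr_gt0 ?ltr0n ?addr_gt0 // big_ord_recr /= addnS.
by apply: lerD IH _; apply: le_ln1Dx; apply: lt_trans p0; rewrite ltrN10.
Qed.

Lemma achievable_bound (R : realType) (theta q c : R) (d m n : nat) :
  0 < q <= 1 -> q ^- n <= theta -> (0 < d)%N ->
  achievable (fun _ : 'I_(d + m) => 1%N) (fun=> 1%R) (fun=> theta) c ->
  0 < c /\ (m%:R + d%:R * (1 + n%:R * (1 - q))) / c +
    \sum_(i < m) (d%:R / (d + i.+1)%:R - 1) <= d%:R.
Proof.
move=> q01 q_theta d0 [disp [T [P [A [b [rat meas ratio]]]]]].
have comp := fun rs o => @competitive_mean_ge _ _ _ _ _ _ _ _ _ rs o meas ratio.
split; last first.
  apply: (adversary_bound q01 q_theta d0 rat _ erefl) => rs o vr so oC o0.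
  exact: (proj2 (comp rs o vr so oC o0)).
have k : 'I_(d + m) by exists 0%N; rewrite ltn_addr.
(* A single buyer who values everything at 1 has a positive optimum, which gives [0 < c]. *)
have [] // := comp (nseq 1 (offer 1 [set: 'I_(d + m)])) [:: Some k].
- apply: valid_rows_offer; rewrite lexx /=.
  by have := price_bounds q01 q_theta (leq0n n); rewrite expr0 invr1 lexx.
- by move=> j; rewrite /= addn0 leq_b1.
- by rewrite /gain /= big_seq1 /= mxE inE ltr01.
Qed.

(** Here [K] is [d e^omega] rounded down, with [d] levels and [q = theta^(-1/d)]. The error on the
    right stays bounded in [d]: [1 / c] comes from rounding, [ln theta ^+ 2 / c] from replacing
    [d (1 - q)] by [ln theta], and the last 1 from the harmonic sum. *)
Lemma achievable_asymptotics (R : realType) (theta omega c : R) (d : nat) :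
  1 < theta -> 0 < omega -> (0 < d)%N ->
  (forall K : nat,
    (0 < K)%N -> achievable (fun _ : 'I_K => 1%N) (fun=> 1%R) (fun=> theta) c) ->
  0 < c /\ d%:R * ((expR omega + ln theta) / c + omega - expR omega)
    <= (1 + ln theta ^+ 2) / c + 1.
Proof.
move=> theta1 omega0 d0 ach; set g := expR omega; set l := ln theta.
have l0 : 0 < l by apply: ln_gt0.
have dR : 0 < d%:R :> R by rewrite ltr0n.
have g1 : 1 < g by rewrite expR_gt1.
pose K := Num.trunc (d%:R * g).
have /andP[Kle Kgt] : K%:R <= d%:R * g < K.+1%:R.
  by apply: truncn_itv; rewrite mulr_ge0 ?ltW // (lt_trans ltr01).
have dK : (d <= K)%N.
  by rewrite /K truncn_ge_nat ?ler_peMr ?(ltW g1) ?ltW // mulr_gt0 // (lt_trans ltr01).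
pose x := l / d%:R; have x0 : 0 < x by rewrite divr_gt0.
have q01 : 0 < expR (- x) <= 1 by rewrite expR_gt0 -expR0 ler_expR oppr_le0 ltW.
have qd : expR (- x) ^- d <= theta.
  rewrite -expRM_natl mulrN expRN invrK /x mulrCA divff ?mulr1 ?gt_eqF // lnK //.
  by rewrite posrE (lt_trans ltr01).
have [] := @achievable_bound R theta (expR (- x)) c d (K - d) d q01 qd d0.
  by rewrite subnKC //; apply: ach; apply: leq_trans dK.
move=> c0 bound; split=> //.
(* Second-order bound: [e^(-x) <= 1 / (1 + x) <= 1 - x + x^2], with [x = l / d]. *)
have qx : l - l ^+ 2 / d%:R <= d%:R * (1 - expR (- x)).
  have -> : l - l ^+ 2 / d%:R = d%:R * (x - x ^+ 2).
    by rewrite /x; field; rewrite gt_eqF.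
  rewrite ler_pM2l // expRN.
  have ex : (expR x)^-1 <= (1 + x)^-1.
    by rewrite lef_pV2 ?posrE ?expR_gt0 ?expR_ge1Dx // addr_gt0.
  suff : (1 + x)^-1 <= 1 - x + x ^+ 2 by move: ex; lra.
  rewrite -div1r ler_pdivrMr ?addr_gt0 //.
  rewrite [leRHS](_ : _ = 1 + x ^+ 3); last by ring.
  by rewrite lerDl exprn_ge0 // ltW.
(* Since [K + 1 > d g], the ratio [(K + 1) / (d + 1)] exceeds [g / (1 + 1 / d)], whose logarithm is
   at least [omega - 1 / d]. *)
have Hge : omega - d%:R^-1 <= \sum_(i < K - d) (d + i.+1)%:R^-1.
  apply: le_trans (harmonic_ge_ln R d (K - d)); rewrite subnKC //.
  have : ln (1 + d%:R^-1 : R) <= d%:R^-1.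
    by apply: le_ln1Dx; rewrite (lt_trans (ltrN10 R)) // invr_gt0.
  have dp : 0 < 1 + d%:R^-1 :> R by rewrite addr_gt0 // invr_gt0.
  have : ln (g / (1 + d%:R^-1)) <= ln (K.+1%:R / d.+1%:R).
    rewrite ler_ln ?posrE ?divr_gt0 ?ltr0n ?expR_gt0 //.
    rewrite -[d.+1%:R]natr1 ler_pdivlMr ?addr_gt0 //.
    rewrite [leLHS](_ : _ = d%:R * g); first exact: ltW.
    by field; rewrite !gt_eqF // addr_gt0.
  by rewrite ln_div ?posrE ?expR_gt0 // expRK; lra.
move: bound; rewrite big_split /= -mulr_sumr sumr_const card_ord mulNrn natrB //.
set H := \sum_(i < _) _ in Hge *; set N := d%:R * (1 - expR (- x)) in qx *.
move=> bound.
have dH : d%:R * omega - 1 <= d%:R * H.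
  by move: Hge; rewrite -(ler_pM2l dR) mulrBr divff // gt_eqF.
have dN : d%:R * l - l ^+ 2 <= d%:R * N.
  by move: qx; rewrite -(ler_pM2l dR) mulrBr mulrCA divff ?mulr1 // gt_eqF.
have : (d%:R * g - 1 + d%:R * l - l ^+ 2) / c <=
    (K%:R - d%:R + d%:R * (1 + N)) / c.
  rewrite ler_pM2r ?invr_gt0 //; move: Kgt; rewrite -natr1; lra.
move: bound Kle dH; rewrite -/N.
have -> : d%:R * ((g + l) / c + omega - g) =
  (d%:R * g - 1 + d%:R * l - l ^+ 2) / c + (1 + l ^+ 2) / c + d%:R * omega - d%:R * g.
  by field; rewrite gt_eqF.
lra.
Qed.
Unset Implicit Arguments.

Theorem theorem3 (R : realType) (theta omega : R)
    (theta_gt1 : 1 < theta) (omega01 : 0 < omega < 1)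
    (omega_sol : expR omega / (expR omega - 1) = ln theta / (1 - omega)) :
  ~ exists c : R,
      c < expR omega / (expR omega - 1) /\
      forall (K : nat) (C : 'I_K -> nat) (L U : 'I_K -> R),
        (forall k, (1 <= C k)%N) ->
        (forall k, 0 < L k <= U k) ->
        max_fluctuation L U = theta ->
        achievable C L U c.
Proof.
move=> [c [c_lt ach]]; have [omega0 omega1] := andP omega01.
(* With [K = 0] the maximal fluctuation would be the default 0 instead of [theta]. *)
have ach1 K : (0 < K)%N ->
    achievable (fun _ : 'I_K => 1%N) (fun=> 1%R) (fun=> theta) c.
  move=> K0; apply: ach => // [k|]; first by rewrite ltr01 ltW.
  rewrite /max_fluctuation divr1; apply/le_anti/andP; split.
    by apply: bigmax_le => //; rewrite ltW // (lt_trans ltr01).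
  exact: (le_bigmax _ _ (Ordinal K0)).
have asym d d0 := @achievable_asymptotics _ _ _ _ d theta_gt1 omega0 d0 ach1.
have [c0 _] := asym 1%N isT.
set g := expR omega in omega_sol c_lt asym; set l := ln theta in omega_sol asym.
have g1 : 1 < g by rewrite expR_gt1.
have g_omega : 0 < g - omega by have := expR_ge1Dx omega; rewrite -/g; lra.
(* The equation for [omega] turns [g + l] into [(g - omega) g / (g - 1)], so positivity is exactly
   [c < g / (g - 1)]. *)
have eps0 : 0 < (g + l) / c + omega - g.
  suff : g - omega < (g + l) / c by lra.
  rewrite ltr_pdivlMr //.
  have -> : g + l = (g - omega) * (g / (g - 1)).
    have -> : l = g / (g - 1) * (1 - omega).
      by rewrite omega_sol divfK // subr_eq0 gt_eqF.
    by field; rewrite subr_eq0 gt_eqF.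
  by rewrite ltr_pM2l.
set eps := _ - g in eps0 asym; set B := _ + 1 in asym.
(* This [d] exceeds [B / eps], contradicting [d * eps <= B]. *)
have [] := asym (Num.trunc (B / eps)).+1 isT.
by move=> _; rewrite -ler_pdivlMr // leNgt truncnS_gt.
Qed.
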